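(* Let $a,b,n\geq 2$ be positive integers such that $\gcd(a,b)=1$. Suppose that there are prime numbers $s\mid a$ and $t\mid b$ such that $\gcd(st,n)=1$. Choose a prime $q$ dividing $n$, and a prime $r$ coprime to $2nab$. Then \[ |\mathrm{Hom}(G_n(GK_{a,b}),\mathbb{W}^{q,r}_{s,t})| < |\mathrm{Hom}(G_n(SK_{a,b}),\mathbb{W}^{q,r}_{s,t})|. \]
   Context: Knot groups. For coprime integers $a,b$ let $T_{a,b}$ be the $(a,b)$-torus knot. For coprime positive integers $a,b$ let $SK_{a,b}=T_{a,b}\# T_{-a,b}$ and $GK_{a,b}=T_{a,b}\# T_{a,b}$ (connect sums). For a knot $K\subset S^3$, the generalised knot group $G_n(K)$ is obtained from $\pi_1(S^3-K)$ by adjoining an $n$th root of the meridian that commutes with the corresponding longitude: if $\pi_1(S^3-K)=\langle g_1,\dots,g_k\mid r_1,\dots,r_\ell\rangle$ and $\mu,\lambda$ are words representing the meridian and longitude, then $G_n(K)=\langle g_1,\dots,g_k,\nu\mid r_1,\dots,r_\ell,\ \nu^n=\mu,\ \nu\lambda=\lambda\nu\rangle$. Replacing $\lambda$ by $\mu^m\lambda$ does not change the group. Concretely, choosing integers $c,d$ with $ad-bc=1$, \[ G_n(GK_{a,b})\cong\langle x,y,w,z,\nu\mid x^a=y^b,\ w^a=z^b,\ \nu^n=y^dx^{-c}=z^dw^{-c},\ x^aw^a\nu=\nu x^aw^a\rangle, \] \[ G_n(SK_{a,b})\cong\langle x,y,w,z,\nu\mid x^a=y^b,\ w^a=z^b,\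 \nu^n=y^dx^{-c}=z^dw^{-c},\ x^aw^{-a}\nu=\nu x^aw^{-a}\rangle. \] Target groups. For distinct primes $q,r$, let $F$ be the splitting field of $x^r-1$ over $\mathbb{F}_q$ (of degree $\mathrm{ord}_r(q)$ over $\mathbb{F}_q$, where $\mathrm{ord}_r(q)$ is the multiplicative order of $q$ modulo $r$), let $\mathbb{V}_q^{(r)}$ be its additive group, and let $E_q^{(r)}\subset F^\times$ be the cyclic group of order $r$ of $r$th roots of unity. The generalised dihedral group is $\mathbb{D}_{q,r}=\mathbb{V}_q^{(r)}\rtimes E_q^{(r)}$ with $(v_1,\zeta_1)(v_2,\zeta_2)=(v_1+\zeta_1v_2,\zeta_1\zeta_2)$. Fixing $1\ne\zeta\in E_q^{(r)}$ and identifying $\zeta^i$ with $i\in\mathbb{Z}_r$, elements are written $(v,i)$ with $(v,i)(u,j)=(v+\zeta^iu,i+j)$, and $[(v,i)]=i\in\mathbb{Z}_r$ defines a homomorphism $[\cdot]:\mathbb{D}_{q,r}\to\mathbb{Z}_r$. For distinct primes $q,r,s,t$, let $\mathcal{C}_{s,t}=\{g\in\mathbb{D}_{s,t}:[g]=1\in\mathbb{Z}_t\}$, a conjugacy class of $\mathbb{D}_{s,t}$, on which $\mathbb{D}_{s,t}$ acts on the right by $g\cdot\alpha=\alpha^{-1}g\alpha$. Then $\mathbb{W}^{q,r}_{s,t}=(\mathbb{D}_{q,r})^{\mathcal{C}_{s,t}}\rtimes\mathbb{D}_{s,t}$, where $\alpha\in\mathbb{D}_{s,t}$ acts on $\omega=(\omega_g)_{g\in\mathcal{C}_{s,t}}$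 by $(\alpha\cdot\omega)_g=\omega_{g\cdot\alpha}$; elements are $\alpha=((\alpha_g)_{g\in\mathcal{C}_{s,t}},\hat\alpha)$ with $(\alpha\beta)_g=\alpha_g\beta_{g\cdot\hat\alpha}$ and $\widehat{\alpha\beta}=\hat\alpha\hat\beta$. $\mathrm{Hom}(G,H)$ is the set of group homomorphisms $G\to H$. *)

(* Defs.v *)
From HB Require Import structures.
From mathcomp Require Import all_boot all_order all_fingroup all_algebra.
From mathcomp Require Import all_field.
From mathcomp Require Import boolp classical_sets cardinality.

Import GRing.Theory.

Set Implicit Arguments.
Unset Strict Implicit.
Unset Printing Implicit Defensive.

Section Words.
Variable X : Type.

(* A letter (x, false) stands for the generator x, and (x, true) for its
   formal inverse; words are not assumed to be reduced. *)
Definition word : Type := seq (X * bool).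

Definition letter (x : X) : word := [:: (x, false)].

Definition winv (u : word) : word := rev [seq (l.1, ~~ l.2) | l <- u].

Definition wexp (u : word) (k : int) : word :=
  match k with
  | Posz n => flatten (nseq n u)
  | Negz n => flatten (nseq n.+1 (winv u))
  end.

Lemma winv_cat u v : winv (u ++ v) = winv v ++ winv u.
Proof. by rewrite /winv map_cat rev_cat. Qed.

Lemma winvK : involutive winv.
Proof.
move=> u; rewrite /winv map_rev revK -map_comp -[RHS]map_id.
by apply: eq_map => -[x e] /=; rewrite negbK.
Qed.

End Words.

Definition wmap (X Y : Type) (h : X -> Y) (u : word X) : word Y :=
  [seq (h l.1, l.2) | l <- u].

(* A pair (u, v) in relators is the relation u = v. *)
Record presentation : Type := Presentation {
  gen : finType;
  relators : seq (word gen * word gen)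
}.

Section PresentedGroup.
Variable P : presentation.

Inductive word_eqv : word (gen P) -> word (gen P) -> Prop :=
| we_refl u : word_eqv u u
| we_sym u v : word_eqv u v -> word_eqv v u
| we_trans v u w : word_eqv u v -> word_eqv v w -> word_eqv u w
| we_cat u u' v v' :
    word_eqv u u' -> word_eqv v v' -> word_eqv (u ++ v) (u' ++ v')
| we_cancel x e : word_eqv [:: (x, e); (x, ~~ e)] [::]
| we_relator u v : (u, v) \in relators P -> word_eqv u v.

Lemma we_catV u : word_eqv (u ++ winv u) [::].
Proof.
elim: u => [|[x e] u IHu]; first exact: we_refl.
rewrite -cat1s winv_cat -catA (catA u).
apply: we_trans (we_cancel x e).
apply: (@we_cat _ [:: (x, e)] _ [:: (x, ~~ e)]); first exact: we_refl.
exact: (we_cat IHu (we_refl _)).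
Qed.

Lemma we_catVr u : word_eqv (winv u ++ u) [::].
Proof. by rewrite -{2}(winvK u); apply: we_catV. Qed.

Lemma we_winv u v : word_eqv u v -> word_eqv (winv u) (winv v).
Proof.
move=> uv; apply: (@we_trans (winv u ++ v ++ winv v)).
  rewrite -[X in word_eqv X]cats0; apply: we_cat; first exact: we_refl.
  exact/we_sym/we_catV.
rewrite catA -[X in word_eqv _ X]cat0s; apply: we_cat; last exact: we_refl.
apply: we_trans (we_catVr u).
by apply: we_cat; [exact: we_refl | exact: we_sym].
Qed.

Definition word_rel : rel (word (gen P)) := fun u v => `[< word_eqv u v >].

Lemma word_rel_refl : reflexive word_rel.
Proof. by move=> u; apply/asboolP/we_refl. Qed.

Lemma word_rel_sym : symmetric word_rel.
Proof. by move=> u v; apply/asboolP/asboolP; apply: we_sym. Qed.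

Lemma word_rel_trans : transitive word_rel.
Proof.
by move=> v u w /asboolP uv /asboolP vw; apply/asboolP/(we_trans uv vw).
Qed.

Canonical word_equiv :=
  EquivRel word_rel word_rel_refl word_rel_sym word_rel_trans.

Definition presented_group : Type := {eq_quot word_equiv}%qT.

HB.instance Definition _ := Choice.on presented_group.
HB.instance Definition _ := EqQuotient.on presented_group.

Definition pg_class (u : word (gen P)) : presented_group :=
  (\pi_presented_group u)%qT.

Definition pg_mul (g h : presented_group) : presented_group :=
  pg_class (generic_quotient.repr g ++ generic_quotient.repr h).
Definition pg_inv (g : presented_group) : presented_group :=
  pg_class (winv (generic_quotient.repr g)).
Definition pg_one : presented_group := pg_class [::].

Lemma pg_classP u v : pg_class u = pg_class v <-> word_eqv u v.
Proof.
split=> [uv|uv]; first by apply/asboolP/(eqmodP word_equiv).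
exact/(eqmodP word_equiv)/asboolP.
Qed.

Lemma pg_repr u : word_eqv (generic_quotient.repr (pg_class u)) u.
Proof. by apply/pg_classP; rewrite /pg_class generic_quotient.reprK. Qed.

Lemma pg_classE (g : presented_group) : g = pg_class (generic_quotient.repr g).
Proof. by rewrite /pg_class generic_quotient.reprK. Qed.

Lemma pg_classM u v : pg_mul (pg_class u) (pg_class v) = pg_class (u ++ v).
Proof. by apply/pg_classP; apply: we_cat; apply: pg_repr. Qed.

Lemma pg_classV u : pg_inv (pg_class u) = pg_class (winv u).
Proof. by apply/pg_classP; apply/we_winv/pg_repr. Qed.

Lemma pg_mulA : associative pg_mul.
Proof.
move=> f g h; rewrite (pg_classE f) (pg_classE g) (pg_classE h).
by rewrite !pg_classM catA.
Qed.

Lemma pg_mul1g : left_id pg_one pg_mul.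
Proof. by move=> g; rewrite (pg_classE g) /pg_one pg_classM. Qed.

Lemma pg_mulg1 : right_id pg_one pg_mul.
Proof. by move=> g; rewrite (pg_classE g) /pg_one pg_classM cats0. Qed.

Lemma pg_mulVg : left_inverse pg_one pg_inv pg_mul.
Proof.
move=> g; rewrite (pg_classE g) pg_classV pg_classM.
exact/pg_classP/we_catVr.
Qed.

Lemma pg_mulgV : right_inverse pg_one pg_inv pg_mul.
Proof.
move=> g; rewrite (pg_classE g) pg_classV pg_classM.
exact/pg_classP/we_catV.
Qed.

HB.instance Definition _ := isGroup.Build presented_group
  pg_mulA pg_mul1g pg_mulg1 pg_mulVg pg_mulgV.

End PresentedGroup.

(* The group pi_1(S^3 - K) of a knot K, together with words representing a
   meridian mu and, up to a factor mu^m, the corresponding longitude lambda: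
   only mu and the coset of lambda modulo powers of mu enter into G_n(K). *)
Record knot_data : Type := KnotData {
  knot_pres : presentation;
  meridian : word (gen knot_pres);
  longitude : word (gen knot_pres)
}.

Definition knot_group (K : knot_data) : groupType :=
  presented_group (knot_pres K).

(* For coprime a and b, with a d - b c = 1: the group <x, y | x^a = y^b>, with
   mu = y^d x^(-c).  The central element x^a is mu^(a b) lambda for the
   preferred longitude lambda. *)
Definition torus_knot (a b : nat) (c d : int) : knot_data :=
  let x := letter true in
  let y := letter false in
  @KnotData (Presentation [:: (wexp x a, wexp y b)])
    (wexp y d ++ wexp x (- c)%R) (wexp x a).

(* The mirror image has the same group, with (mu, lambda) replaced by
   (mu, lambda^(-1)); the mirror image of T_{a,b} is T_{-a,b}. *)
Definition mirror (K : knot_data) : knot_data :=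
  KnotData (meridian K) (winv (longitude K)).

(* By van Kampen, the group of K # L is the free product of those of K and L
   with the two meridians identified, and a longitude is the product of the
   longitudes. *)
Definition connected_sum (K L : knot_data) : knot_data :=
  let i := wmap (@inl (gen (knot_pres K)) (gen (knot_pres L))) in
  let j := wmap (@inr (gen (knot_pres K)) (gen (knot_pres L))) in
  @KnotData
    (Presentation
       ([seq (i p.1, i p.2) | p <- relators (knot_pres K)] ++
        [seq (j p.1, j p.2) | p <- relators (knot_pres L)] ++
        [:: (i (meridian K), j (meridian L))]))
    (i (meridian K)) (i (longitude K) ++ j (longitude L)).

Definition granny_knot (a b : nat) (c d : int) : knot_data :=
  connected_sum (torus_knot a b c d) (torus_knot a b c d).

Definition square_knot (a b : nat) (c d : int) : knot_data :=
  connected_sum (torus_knot a b c d) (mirror (torus_knot a b c d)).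

(* The new generator None is the n-th root nu of the meridian. *)
Definition generalised_knot_pres (n : nat) (K : knot_data) : presentation :=
  let nu : word (option (gen (knot_pres K))) := letter None in
  let i := wmap (@Some (gen (knot_pres K))) in
  @Presentation (option (gen (knot_pres K)))
    ([seq (i p.1, i p.2) | p <- relators (knot_pres K)] ++
     [:: (wexp nu n, i (meridian K));
         (nu ++ i (longitude K), i (longitude K) ++ nu)]).

Definition generalised_knot_group (n : nat) (K : knot_data) : groupType :=
  presented_group (generalised_knot_pres n K).

Definition group_Hom (G H : groupType) : set (G -> H) :=
  [set f : G -> H | {morph f : x y / (x * y)%g}]%classic.
Arguments group_Hom : clear implicits.

Definition card_lt (T U : Type) (A : set T) (B : set U) : bool :=
  ((A #<= B) && ~~ (B #<= A))%card.

Section Dihedral.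
Local Open Scope ring_scope.
Variables (F : finFieldType) (r : nat).

(* The condition z != 0 is redundant unless r = 0. *)
Definition unity_roots : Type := {z : F | (z != 0) && (z ^+ r == 1)}.

HB.instance Definition _ := SubType.on unity_roots.
HB.instance Definition _ := Finite.on unity_roots.

Fact ur_one_subproof : ((1 : F) != 0) && ((1 : F) ^+ r == 1).
Proof. by rewrite oner_eq0 expr1n eqxx. Qed.
Definition ur_one : unity_roots := Sub 1 ur_one_subproof.

Fact ur_mul_subproof (z w : unity_roots) :
  (val z * val w != 0) && ((val z * val w) ^+ r == 1).
Proof.
have /andP[z0 /eqP z1] := valP z; have /andP[w0 /eqP w1] := valP w.
by rewrite mulf_neq0 // exprMn z1 w1 mulr1 eqxx.
Qed.
Definition ur_mul (z w : unity_roots) : unity_roots :=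
  Sub (val z * val w) (ur_mul_subproof z w).

Fact ur_inv_subproof (z : unity_roots) :
  ((val z)^-1 != 0) && ((val z)^-1 ^+ r == 1).
Proof.
have /andP[z0 /eqP z1] := valP z.
by rewrite invr_eq0 z0 exprVn z1 invr1 eqxx.
Qed.
Definition ur_inv (z : unity_roots) : unity_roots :=
  Sub (val z)^-1 (ur_inv_subproof z).

(* Elements are the pairs (v, z) with z a root of unity; once zeta != 1 is
   fixed, (v, zeta ^+ i) is the element denoted (v, i) with i in Z_r. *)
Definition dihedral : Type := (F * unity_roots)%type.

HB.instance Definition _ := Finite.on dihedral.

Definition dih_mul (g h : dihedral) : dihedral :=
  (g.1 + val g.2 * h.1, ur_mul g.2 h.2).
Definition dih_one : dihedral := (0, ur_one).
Definition dih_inv (g : dihedral) : dihedral :=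
  (- ((val g.2)^-1 * g.1), ur_inv g.2).

Lemma dih_mulA : associative dih_mul.
Proof.
move=> f g h; congr pair; first by rewrite /= mulrDr addrA mulrA.
by apply: val_inj; rewrite /= mulrA.
Qed.

Lemma dih_mul1g : left_id dih_one dih_mul.
Proof.
case=> v z; congr pair; first by rewrite /= mul1r add0r.
by apply: val_inj; rewrite /= mul1r.
Qed.

Lemma dih_mulVg : left_inverse dih_one dih_inv dih_mul.
Proof.
case=> v z; congr pair; first by rewrite /= addNr.
apply: val_inj; rewrite /= mulVf //.
by have /andP[] := valP z.
Qed.

HB.instance Definition _ :=
  Finite_isGroup.Build dihedral dih_mulA dih_mul1g dih_mulVg.

(* Relative to the choice of zeta, [g] = 1 in Z_r means that g = (v, zeta). *)
Definition dih_class (zeta : F) : Type :=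
  {g : dihedral | val g.2 == zeta}.

HB.instance Definition _ (zeta : F) := SubType.on (dih_class zeta).
HB.instance Definition _ (zeta : F) := Finite.on (dih_class zeta).

Fact dih_conj_subproof (zeta : F) (g : dih_class zeta) (alpha : dihedral) :
  val (val g ^ alpha)%g.2 == zeta.
Proof.
rewrite /= mulrCA mulVf ?mulr1; first exact: (valP g).
by have /andP[] := valP alpha.2.
Qed.
Definition dih_conj (zeta : F) (g : dih_class zeta) (alpha : dihedral) :
    dih_class zeta :=
  Sub (val g ^ alpha)%g (dih_conj_subproof g alpha).

Lemma dih_conj1 zeta (g : dih_class zeta) : dih_conj g 1%g = g.
Proof. by apply: val_inj; rewrite /= conjg1. Qed.

Lemma dih_conjM zeta (g : dih_class zeta) (alpha beta : dihedral) :
  dih_conj g (alpha * beta)%g = dih_conj (dih_conj g alpha) beta.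
Proof. by apply: val_inj; rewrite /= conjgM. Qed.

End Dihedral.

Section Wreath.
Local Open Scope group_scope.
Variables (A : finGroupType) (F : finFieldType) (t : nat) (zeta : F).
Let D : finGroupType := dihedral F t.

Definition wreath : Type :=
  ({ffun @dih_class F t zeta -> A} * dihedral F t)%type.

HB.instance Definition _ := Finite.on wreath.

Definition wr_mul (x y : wreath) : wreath :=
  ([ffun g => x.1 g * y.1 (dih_conj g x.2)], (x.2 : D) * y.2).
Definition wr_one : wreath := ([ffun=> 1], 1 : D).
Definition wr_inv (x : wreath) : wreath :=
  ([ffun g => (x.1 (dih_conj g (x.2 : D)^-1))^-1], (x.2 : D)^-1).

Lemma wr_mulA : associative wr_mul.
Proof.
move=> x y z; congr pair; last by rewrite /= mulgA.
by apply/ffunP=> g; rewrite !ffunE dih_conjM mulgA.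
Qed.

Lemma wr_mul1g : left_id wr_one wr_mul.
Proof.
case=> f d; congr pair; last by rewrite /= mul1g.
by apply/ffunP=> g; rewrite !ffunE /= dih_conj1 mul1g.
Qed.

Lemma wr_mulVg : left_inverse wr_one wr_inv wr_mul.
Proof.
move=> x; congr pair; last by rewrite /= mulVg.
by apply/ffunP=> g; rewrite !ffunE /= mulVg.
Qed.

HB.instance Definition _ :=
  Finite_isGroup.Build wreath wr_mulA wr_mul1g wr_mulVg.

End Wreath.

Definition is_splitting_field_unity (q r : nat) (F : fieldExtType 'F_q) :
    Prop :=
  splittingFieldFor 1%VS ('X^r - 1 : {poly F})%R (fullv : {vspace F}).

Definition DD (q r : nat) (F : fieldExtType 'F_q) : finGroupType :=
  dihedral (finvect_type F) r.

Definition WW (q r s t : nat) (F : fieldExtType 'F_q) (K : fieldExtType 'F_s)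
    (zeta : K) : finGroupType :=
  @wreath (DD r F) (finvect_type K) t zeta.

(* Main.v *)
Require Import Defs.
From mathcomp Require Import all_boot all_order all_fingroup all_algebra.
From mathcomp Require Import all_field.
From mathcomp Require Import boolp classical_sets cardinality.
From mathcomp Require Import pgroup abelian zify.

(* Write Z = x^a for the central element of the torus knot group and nu for the
   n-th root of the meridian.  For fixed nu in a finite group H, let N_h and M_h
   count the pairs (x, y) with meridian nu^n for which nu conjugated by Z,
   respectively by Z^-1, is h.  Homomorphisms to H number sum_nu sum_h N_h M_h
   for the granny knot and sum_nu sum_h N_h^2 for the square knot; the latter
   is also sum_nu sum_h M_h^2 since torus knots are invertible.  As
   2 N M <= N^2 + M^2, the inequality always holds weakly, and it is strict as
   soon as some (nu, x, y) admits no (w, z) completing it for the granny knot.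

   In the wreath product, take the nonabelian representation of the torus knot
   group in D_{s,t}, twisted by xi of order r and by a coboundary, so that the
   meridian m has trivial component at the point p fixed by its image; then
   nu is an n-th root of m whose component at p is a nontrivial translation.
   Granny compatibility at p forces the Z_r-classes at p of x^a and w^a to
   cancel.  The former is xi^(ab).  The latter is 1 when the image of w in
   D_{s,t} is trivial; otherwise it does not depend on the point, by
   transitivity, and the product over all points makes it xi^(ab).  Neither is
   possible, r being prime to 2ab. *)

Set Implicit Arguments.
Unset Strict Implicit.
Unset Printing Implicit Defensive.
Import GRing.Theory.

(** * Homomorphisms from a presented group *)

Section WordValue.
Local Open Scope group_scope.
Variables (H : finGroupType) (X : Type).
Implicit Types (f : X -> H) (u v : word X).

Definition wval f u : H := \prod_(l <- u) (if l.2 then (f l.1)^-1 else f l.1).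

Lemma wval_nil f : wval f [::] = 1.
Proof. by rewrite /wval big_nil. Qed.

Lemma wval_cat f u v : wval f (u ++ v) = wval f u * wval f v.
Proof. by rewrite /wval big_cat. Qed.

Lemma wval_letter f x : wval f (letter x) = f x.
Proof. by rewrite /wval big_seq1. Qed.

Lemma wval_winv f u : wval f (winv u) = (wval f u)^-1.
Proof.
elim: u => [|[x e] u IHu]; first by rewrite wval_nil invg1.
rewrite -cat1s winv_cat !wval_cat invMg IHu; congr (_ * _).
by rewrite /wval !big_seq1; case: e; rewrite ?invgK.
Qed.

Lemma wval_wexp_nat f u (k : nat) : wval f (wexp u k%:Z) = wval f u ^+ k.
Proof. by elim: k => [|k IHk] /=; rewrite ?wval_nil ?wval_cat ?expgS ?IHk. Qed.

Lemma wval_wexp_opp f u (k : int) : wval f (wexp u (- k)%R) = (wval f (wexp u k))^-1.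
Proof.
case: k => [[|k]|k]; first by rewrite wval_nil invg1.
- rewrite wval_wexp_nat -[wexp u (- _)%R]/(wexp (winv u) k.+1%:Z).
  by rewrite wval_wexp_nat wval_winv expgVn.
rewrite NegzE opprK wval_wexp_nat -NegzE.
by rewrite -[wexp u (Negz _)]/(wexp (winv u) k.+1%:Z) wval_wexp_nat wval_winv expgVn invgK.
Qed.

Lemma wval_wexpD f u (k : int) (m : nat) :
  wval f (wexp u (k + m%:Z)%R) = wval f (wexp u k) * wval f u ^+ m.
Proof.
elim: m => [|m IHm]; first by rewrite addr0 mulg1.
rewrite expgSr mulgA -IHm -addn1 PoszD addrA; move: (k + m)%R => {IHm}[j|j].
  by rewrite -PoszD !wval_wexp_nat addn1 expgSr.
(* [Negz j] is -(j + 1), so one more step lands on -j, which is 0 when j = 0. *)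
have -> : (Negz j + 1 = - j%:Z)%R by rewrite NegzE -addn1 PoszD opprD addrNK.
by rewrite NegzE !wval_wexp_opp !wval_wexp_nat expgS invMg mulgKV.
Qed.

End WordValue.

Lemma wval_wmap (H : finGroupType) (X Y : Type) (h : X -> Y) (f : Y -> H) u :
  wval f (wmap h u) = wval (f \o h) u.
Proof. by rewrite /wval big_map. Qed.

Section Homs.
Local Open Scope group_scope.
Variables (H : finGroupType) (P : presentation).

Definition respects (f : gen P -> H) :=
  all (fun p => wval f p.1 == wval f p.2) (relators P).

Lemma wval_eqv (f : gen P -> H) u v :
  respects f -> @word_eqv P u v -> wval f u = wval f v.
Proof.
move/allP=> fP; elim=> {u v} [//|u v _ ->//|v u w _ -> _ //|u u' v v' _ eu _ ev|x e|u v].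
- by rewrite !wval_cat eu ev.
- rewrite /wval big_cons big_seq1 big_nil /=.
  by case: e; rewrite /= ?mulVg ?mulgV.
by move=> /fP/eqP.
Qed.

Lemma pg_class_mulg u v : @pg_class P u * @pg_class P v = pg_class (u ++ v).
Proof. exact: pg_classM. Qed.

Lemma pg_class_invg u : (@pg_class P u)^-1 = pg_class (winv u).
Proof. exact: pg_classV. Qed.

Definition hom_of (f : gen P -> H) (g : presented_group P) : H :=
  wval f (generic_quotient.repr g).

Lemma hom_of_class f u : respects f -> hom_of f (pg_class u) = wval f u.
Proof. by move=> fP; apply: wval_eqv => //; apply: pg_repr. Qed.

Lemma hom_ofM f : respects f -> {morph hom_of f : x y / x * y}.
Proof.
move=> fP x y.
rewrite (pg_classE x) (pg_classE y).
by rewrite pg_class_mulg !hom_of_class // wval_cat.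
Qed.

Definition on_generators (phi : presented_group P -> H) : {ffun gen P -> H} :=
  [ffun x => phi (pg_class (letter x))].

Lemma group_HomE phi u :
  group_Hom (presented_group P) H phi ->
  phi (pg_class u) = wval (on_generators phi) u.
Proof.
move=> phiM.
have phi1 : phi 1 = 1 by apply: (mulgI (phi 1)); rewrite -phiM !mulg1.
have phiV x : phi x^-1 = (phi x)^-1.
  by apply: (mulgI (phi x)); rewrite -phiM !mulgV.
elim: u => [|[x e] u IHu]; first by rewrite wval_nil.
rewrite -cat1s wval_cat -pg_class_mulg phiM IHu.
congr (_ * _); rewrite /wval big_seq1 ffunE /=; case: e => //.
by rewrite -phiV pg_class_invg.
Qed.

(** Restriction to the generators is a bijection: values that satisfy the relators extend by
    evaluating words. The count thus takes place in a finite type, although the presented group may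
    be infinite. *)
Lemma card_group_Hom :
  (group_Hom (presented_group P) H #= `I_#|[set f : {ffun gen P -> H} | respects f]|)%card.
Proof.
set S := [set f | _].
have injS : {in [set: 'I_#|S|]%classic &, injective (@enum_val _ (mem S))}.
  by move=> i j _ _; apply: enum_val_inj.
apply: card_eq_trans (card_esym card_II).
apply: card_eq_trans (inj_card_eq injS).
rewrite card_eq_sym.
have inj_gen : {in group_Hom (presented_group P) H &, injective on_generators}.
  move=> phi psi /set_mem phiM /set_mem psiM eq_gen; apply/funext => g.
  by rewrite (pg_classE g) !group_HomE // eq_gen.
apply: card_eq_trans (inj_card_eq inj_gen).
rewrite [X in (X #= _)%card](_ : _ = [set` S]%classic).
  suff -> : (on_generators @` group_Hom (presented_group P) H = [set` S])%classic.
    exact: card_eqxx.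
  apply/seteqP; split=> f /=.
    move=> [phi phiM <-]; rewrite inE; apply/allP=> -[u v] uv /=.
    by rewrite -!group_HomE //; apply/eqP; congr phi; apply/pg_classP/we_relator.
  rewrite inE => fP; exists (hom_of f); first exact: hom_ofM.
  by apply/ffunP=> x; rewrite ffunE hom_of_class // wval_letter.
apply/seteqP; split=> f /=.
  by move=> [i _ <-]; apply: enum_valP.
by move=> fS; exists (enum_rank_in fS f); rewrite ?enum_rankK_in.
Qed.

End Homs.

Lemma card_lt_group_Hom (H : finGroupType) (P Q : presentation) :
  (#|[set f : {ffun gen P -> H} | respects f]|
     < #|[set f : {ffun gen Q -> H} | respects f]|)%N ->
  card_lt (group_Hom (presented_group P) H) (group_Hom (presented_group Q) H).
Proof.
move=> ltPQ; rewrite /card_lt.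
rewrite (card_le_eql (card_group_Hom H P)) (card_le_eqr (card_group_Hom H Q)).
rewrite (card_le_eql (card_group_Hom H Q)) (card_le_eqr (card_group_Hom H P)).
by rewrite !card_le_II -ltnNge ltPQ ltnW.
Qed.

(** * Counting for the granny and square knots *)

Section TorusPairs.
Local Open Scope group_scope.
Variables (H : finGroupType) (a b c d : nat).
Implicit Types (nu h : H) (p : H * H).

(** When a d - b c = 1, these are the homomorphisms from the torus knot group that send the meridian
    to [m]. *)
Definition torus_pairs (m : H) : {set H * H} :=
  [set p | (p.1 ^+ a == p.2 ^+ b) && (p.2 ^+ d * p.1 ^- c == m)].

Lemma torus_pairsP m x y :
  reflect (x ^+ a = y ^+ b /\ y ^+ d * x ^- c = m) ((x, y) \in torus_pairs m).
Proof. by rewrite inE; apply: (iffP andP) => [[/eqP-> /eqP]|[-> ->]]. Qed.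

Definition granny_tuples n : {set H * ((H * H) * (H * H))} :=
  [set u | [&& u.2.1 \in torus_pairs (u.1 ^+ n), u.2.2 \in torus_pairs (u.1 ^+ n)
             & u.1 ^ (u.2.1.1 ^+ a * u.2.2.1 ^+ a) == u.1]].

Definition square_tuples n : {set H * ((H * H) * (H * H))} :=
  [set u | [&& u.2.1 \in torus_pairs (u.1 ^+ n), u.2.2 \in torus_pairs (u.1 ^+ n)
             & u.1 ^ (u.2.1.1 ^+ a * u.2.2.1 ^- a) == u.1]].

(* The invertibility of torus knots: x |-> x^-1, y |-> y^-1, followed by the
   conjugation that carries the meridian exactly to its inverse. *)
Definition torus_invert p := (p.1^-1, p.2^-1 ^ (p.1 ^- c)).

Lemma torus_invertK : involutive torus_invert.
Proof.
move=> [x y]; rewrite /torus_invert /= invgK; congr (_, _).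
by rewrite -conjVg invgK -conjgM expgVn invgK mulVg conjg1.
Qed.

(** The conjugation turns the meridian y^-d x^c of the inverted pair into x^c y^-d, and it fixes
    y^-b = x^-a, which commutes with x. *)
Lemma torus_invert_mem m p :
  (torus_invert p \in torus_pairs m^-1) = (p \in torus_pairs m).
Proof.
suff sub q k : q \in torus_pairs k -> torus_invert q \in torus_pairs k^-1.
  apply/idP/idP => [/sub|]; last exact: sub.
  by rewrite invgK torus_invertK.
case: q => x y; rewrite !inE /= => /andP[/eqP xy /eqP <-].
rewrite -!conjXg !expVgn invgK invMg invgK {2}/conjg !invgK mulgA mulgKV eqxx andbT.
by rewrite -xy conjgE invgK mulgA (commuteV (commuteX2 _ _ (commute_refl x))) mulgK.
Qed.

End TorusPairs.

Definition encode (H : finGroupType) (u : H * ((H * H) * (H * H))) :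
    {ffun option (bool + bool) -> H} :=
  [ffun o => match o with
   | None => u.1
   | Some (inl e) => if e then u.2.1.1 else u.2.1.2
   | Some (inr e) => if e then u.2.2.1 else u.2.2.2
   end].

Lemma encode_bij H : bijective (@encode H).
Proof.
exists (fun f : {ffun option (bool + bool) -> H} =>
  (f None, ((f (Some (inl true)), f (Some (inl false))),
            (f (Some (inr true)), f (Some (inr false)))))).
  by move=> [nu [[x y] [w z]]]; rewrite !ffunE.
by move=> f; apply/ffunP=> -[[[]|[]]|]; rewrite ffunE.
Qed.

Lemma conjg_eqP (H : finGroupType) (x y : H) :
  (x ^ y == x)%g = (x * y == y * x)%g.
Proof. by rewrite -(inj_eq (mulgI y)) conjgE mulKVg. Qed.

(** Separates the longitudes of the two summands, so that the tuples over a given nu form a fibre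
    product of two sets of pairs. *)
Lemma conjgM_eq (H : finGroupType) (x y z : H) :
  (x ^ (y * z) == x)%g = (x ^ y == x ^ z^-1)%g.
Proof. by rewrite -(inj_eq (@conjg_inj _ z^-1%g)) conjgM conjgK. Qed.

(* As x^a = y^b, adding a multiple of (a, b) to (c, d) does not change
   y^d x^(-c); this allows natural exponents. *)
Lemma wval_meridian (H : finGroupType) (X : Type) (f : X -> H) (x y : X)
    (a b c d k : nat) (c0 d0 : int) :
  (c%:Z = c0 + a%:Z * k%:Z)%R -> (d%:Z = d0 + b%:Z * k%:Z)%R ->
  (f x ^+ a = f y ^+ b)%g ->
  (wval f (wexp (letter y) d0) * wval f (wexp (letter x) (- c0)%R)
   = f y ^+ d * f x ^- c)%g.
Proof.
move=> dc dd xy.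
have -> : (f y ^+ d = wval f (wexp (letter y) d0) * f y ^+ (b * k))%g.
  by rewrite -(wval_letter f y) -wval_wexp_nat dd -PoszM wval_wexpD.
have -> : (f x ^+ c = wval f (wexp (letter x) c0) * f x ^+ (a * k))%g.
  by rewrite -(wval_letter f x) -wval_wexp_nat dc -PoszM wval_wexpD.
by rewrite wval_wexp_opp invMg mulgA !expgM xy mulgK.
Qed.

Lemma granny_respects (H : finGroupType) (n a b c d k : nat) (c0 d0 : int) u :
  (c%:Z = c0 + a%:Z * k%:Z)%R -> (d%:Z = d0 + b%:Z * k%:Z)%R ->
  @respects H (generalised_knot_pres n (granny_knot a b c0 d0)) (encode u)
  = (u \in granny_tuples H a b c d n).
Proof.
move=> dc dd; case: u => [nu [[x y] [w z]]].
rewrite /respects /granny_tuples !inE.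
cbn -[wmap wexp letter encode GRing.opp].
rewrite !(wval_cat, wval_wmap) !wval_wexp_nat !wval_letter /= !ffunE /= conjg_eqP.
(* The relators equate the two meridians with each other and one of them with nu^n; the tuples
   equate each with nu^n. The torus relations are settled first because [wval_meridian] needs
   them. *)
have [xy|] := eqVneq (x ^+ a)%g; last by [].
have [wz|] := eqVneq (w ^+ a)%g; last by rewrite !andbF.
rewrite !(wval_meridian dc dd) /= ?ffunE // andbT.
rewrite [in RHS](eq_sym _ (nu ^+ n)%g) [X in _ = _ && (X && _)]eq_sym.
by have [->|] := eqVneq (nu ^+ n)%g; rewrite ?andbF // andbT.
Qed.

Lemma square_respects (H : finGroupType) (n a b c d k : nat) (c0 d0 : int) u :
  (c%:Z = c0 + a%:Z * k%:Z)%R -> (d%:Z = d0 + b%:Z * k%:Z)%R ->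
  @respects H (generalised_knot_pres n (square_knot a b c0 d0)) (encode u)
  = (u \in square_tuples H a b c d n).
Proof.
move=> dc dd; case: u => [nu [[x y] [w z]]].
rewrite /respects /square_tuples !inE.
cbn -[wmap wexp letter encode GRing.opp winv].
rewrite !(wval_cat, wval_wmap) !wval_winv !wval_wexp_nat !wval_letter /= !ffunE /=.
rewrite conjg_eqP.
have [xy|] := eqVneq (x ^+ a)%g; last by [].
have [wz|] := eqVneq (w ^+ a)%g; last by rewrite !andbF.
rewrite !(wval_meridian dc dd) /= ?ffunE // andbT.
rewrite [in RHS](eq_sym _ (nu ^+ n)%g) [X in _ = _ && (X && _)]eq_sym.
by have [->|] := eqVneq (nu ^+ n)%g; rewrite ?andbF // andbT.
Qed.

Lemma card_fiber_product (T I : finType) (A B : {set T}) (f g : T -> I) :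
  #|[set u | [&& u.1 \in A, u.2 \in B & f u.1 == g u.2]]| =
  (\sum_i #|[set p in A | f p == i]| * #|[set p in B | g p == i]|)%N.
Proof.
rewrite -sum1_card (partition_big (fun u => f u.1) xpredT) //=.
apply: eq_bigr => i _; rewrite -cardsX -sum1_card; apply: eq_bigl => u.
rewrite !inE; have [->|] := eqVneq (f u.1) i; last by rewrite !andbF.
by rewrite !andbT eq_sym.
Qed.

Lemma card_pair_set (T U : finType) (S : {set T * U}) :
  #|S| = (\sum_x #|[set y | (x, y) \in S]|)%N.
Proof.
rewrite -sum1_card (eq_bigr (fun x => \sum_(y | (x, y) \in S) 1)%N); last first.
  by move=> x _; rewrite -sum1_card; apply: eq_bigl => y; rewrite inE.
by rewrite pair_big_dep /=; apply: eq_bigl => -[].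
Qed.

Section Counting.
Local Open Scope group_scope.
Variables (H : finGroupType) (a b c d n : nat).
Implicit Types (nu h : H) (p : H * H).

Local Notation pairs nu := (torus_pairs a b c d (nu ^+ n)).
Let N nu h := #|[set p in pairs nu | nu ^ (p.1 ^+ a) == h]|.
Let M nu h := #|[set p in pairs nu | nu ^ (p.1 ^- a) == h]|.

Lemma card_granny : #|granny_tuples H a b c d n| = (\sum_nu \sum_h N nu h * M nu h)%N.
Proof.
rewrite card_pair_set; apply: eq_bigr => nu _; rewrite -card_fiber_product.
by apply: eq_card => -[p p']; rewrite !inE /= conjgM_eq.
Qed.

Lemma card_square : #|square_tuples H a b c d n| = (\sum_nu \sum_h N nu h ^ 2)%N.
Proof.
rewrite card_pair_set; apply: eq_bigr => nu _.
rewrite (eq_bigr _ (fun h _ => esym (mulnn (N nu h)))) -card_fiber_product.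
by apply: eq_card => -[p p']; rewrite !inE /= conjgM_eq invgK.
Qed.

(** Inverting the torus knot carries x^a to x^-a and the meridian to its inverse, with n-th root
    nu^-1. *)
Lemma inverse_fibers nu h : M nu h = N nu^-1 h^-1.
Proof.
rewrite /N -(card_imset _ (inv_inj (@torus_invertK H c))); apply: eq_card => p.
rewrite -[in RHS](torus_invertK c p) mem_imset; last exact/inv_inj/torus_invertK.
rewrite 2!inE [in RHS]inE expgVn torus_invert_mem [in RHS]inE; congr (_ && _).
by rewrite /= expgVn conjVg (inj_eq invg_inj).
Qed.

Lemma card_square_inverse : #|square_tuples H a b c d n| = (\sum_nu \sum_h M nu h ^ 2)%N.
Proof.
rewrite card_square (reindex_inj invg_inj); apply: eq_bigr => nu _ /=.
rewrite (reindex_inj invg_inj); apply: eq_bigr => h _ /=.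
by rewrite inverse_fibers.
Qed.

Lemma granny_lt_square nu0 p0 :
  p0 \in pairs nu0 ->
  (forall p, p \in pairs nu0 -> nu0 ^ (p0.1 ^+ a * p.1 ^+ a) != nu0) ->
  (#|granny_tuples H a b c d n| < #|square_tuples H a b c d n|)%N.
Proof.
move=> Xp0 noXp; rewrite -(ltn_pmul2l (isT : 0 < 2)%N).
rewrite [X in (_ < X)%N]mulSn mul1n {1}card_square card_square_inverse card_granny.
rewrite big_distrr -big_split /=.
pose F nu := (\sum_h (N nu h ^ 2 + M nu h ^ 2))%N.
rewrite [X in (_ < X)%N](eq_bigr F) => [|nu _]; last by rewrite -big_split.
have le_term nu h : (2 * (N nu h * M nu h) <= N nu h ^ 2 + M nu h ^ 2)%N.
  by rewrite nat_Cauchy.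
have leF nu : (2 * \sum_h N nu h * M nu h <= F nu)%N.
  by rewrite big_distrr /=; apply: leq_sum => h _; apply: le_term.
rewrite (bigD1 nu0) //= [X in (_ < X)%N](bigD1 nu0) //= -addSn.
apply: leq_add; last by apply: leq_sum.
(* At h0 the inequality is strict: N is positive because of [p0], and M vanishes by [noXp]. *)
pose h0 := nu0 ^ (p0.1 ^+ a).
rewrite /F big_distrr /= (bigD1 h0) //= [X in (_ < X)%N](bigD1 h0) //= -addSn.
apply: leq_add; last by apply: leq_sum => h _; apply: le_term.
have N_gt0 : (0 < N nu0 h0)%N by apply/card_gt0P; exists p0; rewrite inE Xp0 /=.
suff -> : M nu0 h0 = 0%N by rewrite muln0 muln0 ltn_addr // expn_gt0 N_gt0.
apply/eqP; rewrite cards_eq0; apply/eqP/setP=> p; rewrite finset.in_set0 inE.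
apply/negP => /andP[/noXp]; rewrite conjgM => /eqP ne /eqP eq_h0.
by apply: ne; rewrite -/h0 -eq_h0 conjgKV.
Qed.

End Counting.

Lemma card_lt_granny_square (H : finGroupType) (a b c d n k : nat) (c0 d0 : int)
    nu0 (p0 : H * H) :
  (c%:Z = c0 + a%:Z * k%:Z)%R -> (d%:Z = d0 + b%:Z * k%:Z)%R ->
  p0 \in torus_pairs a b c d (nu0 ^+ n)%g ->
  (forall p, p \in torus_pairs a b c d (nu0 ^+ n)%g ->
     (nu0 ^ (p0.1 ^+ a * p.1 ^+ a) != nu0)%g) ->
  card_lt
    (group_Hom (generalised_knot_group n (granny_knot a b c0 d0)) H)
    (group_Hom (generalised_knot_group n (square_knot a b c0 d0)) H).
Proof.
move=> dc dd Xp0 noXp; apply: card_lt_group_Hom.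
(* [genP] reads a finite function on option (bool + bool) as a function on [gen P]; for both knots
   these types are convertible. *)
have card_enc (P : presentation) (genP : {ffun option (bool + bool) -> H} -> gen P -> H)
    (S : {set _}) : (forall u, respects (genP (encode u)) = (u \in S)) ->
    #|[set f | respects (genP f)]| = #|S|.
  move=> encP; have -> : S = @encode H @^-1: [set f | respects (genP f)].
    by apply/setP=> u; rewrite 2!inE encP.
  by rewrite on_card_preimset //; apply/onW_bij/encode_bij.
rewrite (card_enc (generalised_knot_pres n (granny_knot a b c0 d0)) _ _
  (fun u => granny_respects n u dc dd)).
rewrite (card_enc (generalised_knot_pres n (square_knot a b c0 d0)) _ _
  (fun u => square_respects n u dc dd)).
exact: granny_lt_square Xp0 noXp.
Qed.

(** * Dihedral and wreath groups *)

Section DihedralFacts.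
Local Open Scope ring_scope.
Variables (F : finFieldType) (r : nat).
Implicit Types (g h : dihedral F r) (v : F).

Definition dih_rot g : F := val g.2.

Definition translation v : dihedral F r := (v, ur_one F r).

Lemma dih_eqP g h : g.1 = h.1 -> dih_rot g = dih_rot h -> g = h.
Proof. by case: g h => [v z] [u w] /= -> rot_eq; congr (_, _); apply: val_inj. Qed.

Lemma dih_rot_neq0 g : dih_rot g != 0.
Proof. by have /andP[] := valP g.2. Qed.

Lemma dih_rot_unity g : dih_rot g ^+ r = 1.
Proof. by have /andP[_ /eqP] := valP g.2. Qed.

Lemma dih_rotM g h : dih_rot (g * h)%g = dih_rot g * dih_rot h.
Proof. by []. Qed.

Lemma dih_rotV g : dih_rot g^-1%g = (dih_rot g)^-1.
Proof. by []. Qed.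

Lemma dih_rotX g k : dih_rot (g ^+ k)%g = dih_rot g ^+ k.
Proof. by elim: k => [|k IHk] //; rewrite expgS dih_rotM IHk exprS. Qed.

Lemma dih_fstX g k : (g ^+ k)%g.1 = g.1 * \sum_(i < k) dih_rot g ^+ i.
Proof.
elim: k => [|k IHk]; first by rewrite big_ord0 mulr0.
rewrite expgSr /= IHk -[val _]/(dih_rot (g ^+ k)%g) dih_rotX.
by rewrite big_ord_recr /= mulrDr [_ * g.1]mulrC.
Qed.

(** The translation part of g^k is a multiple of a geometric sum in the rotation, which vanishes at
    a k-th root of unity other than 1. *)
Lemma dih_expr_root g k : dih_rot g != 1 -> dih_rot g ^+ k = 1 -> (g ^+ k)%g = 1%g.
Proof.
move=> g_neq1 gk1; apply: dih_eqP; last by rewrite dih_rotX.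
rewrite dih_fstX (_ : \sum_(i < k) _ = 0) ?mulr0 //.
apply: (@mulfI _ (dih_rot g - 1)); first by rewrite subr_eq0.
by rewrite -subrX1 gk1 subrr mulr0.
Qed.

Lemma translationX v k : (translation v ^+ k)%g = translation (v *+ k).
Proof.
apply: dih_eqP; last by rewrite dih_rotX expr1n.
rewrite dih_fstX (eq_bigr (fun=> 1)) => [|i _]; last by rewrite expr1n.
by rewrite sumr_const card_ord mulr_natr.
Qed.

Lemma translationM u v : (translation u * translation v)%g = translation (u + v).
Proof. by apply: dih_eqP; rewrite /= ?mul1r //= /dih_rot /= mul1r. Qed.

Lemma translationJV v g : (translation v ^ g^-1)%g = translation (dih_rot g * v).
Proof.
apply: dih_eqP; last first.
  rewrite /conjg invgK !dih_rotM dih_rotV [dih_rot (translation v)]/(1 : F).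
  by rewrite mul1r mulfV ?dih_rot_neq0.
rewrite /conjg invgK /= mul1r mulrDr mulrN mulVKf ?dih_rot_neq0 //.
by rewrite addrC subrK.
Qed.

(** Conjugation scales a translation by a rotation. This is how commutation with nu becomes a
    condition on classes in Z_r. *)
Lemma commute_translation v g : v != 0 -> commute g (translation v) -> dih_rot g = 1.
Proof.
move=> v0 /(congr1 fst) /=; rewrite mul1r addrC => /addIr/eqP.
by rewrite -[X in _ == X]mul1r (inj_eq (mulIf v0)) => /eqP.
Qed.

End DihedralFacts.

Section WreathFacts.
Local Open Scope group_scope.
Variables (F K : finFieldType) (r t : nat) (zeta : K).
Local Notation A := (dihedral F r : finGroupType).
Local Notation D := (dihedral K t : finGroupType).
Local Notation C := (@dih_class K t zeta).
Local Notation W := (@wreath A K t zeta : finGroupType).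
Implicit Types (alpha beta : W) (g : C).

Definition wr_rot g alpha : F := dih_rot (alpha.1 g).

Lemma wr_eqP alpha beta :
  (forall g, alpha.1 g = beta.1 g) -> alpha.2 = beta.2 -> alpha = beta.
Proof. by case: alpha beta => [u x] [v y] /= uv ->; congr (_, _); apply/ffunP. Qed.

Lemma wrM1 alpha beta g : (alpha * beta).1 g = alpha.1 g * beta.1 (dih_conj g alpha.2).
Proof. by rewrite ffunE. Qed.

Lemma wrM2 alpha beta : (alpha * beta).2 = alpha.2 * beta.2 :> D.
Proof. by []. Qed.

Lemma wrX2 alpha k : (alpha ^+ k).2 = alpha.2 ^+ k :> D.
Proof. by elim: k => [|k IHk] //; rewrite !expgS wrM2 IHk. Qed.

Lemma wrV2 alpha : (alpha^-1).2 = alpha.2^-1 :> D.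
Proof. by []. Qed.

Lemma wrX_fix alpha g k :
  dih_conj g alpha.2 = g -> (alpha ^+ k).1 g = (alpha.1 g) ^+ k.
Proof.
move=> fix_g; elim: k => [|k IHk]; first by rewrite ffunE.
by rewrite !expgS wrM1 fix_g IHk.
Qed.

Lemma dih_conjX_fix g (x : D) k : dih_conj g x = g -> dih_conj g (x ^+ k) = g.
Proof.
move=> fix_g; elim: k => [|k IHk]; first by rewrite dih_conj1.
by rewrite expgS dih_conjM fix_g.
Qed.

Lemma dih_conj_inj (x : D) : injective (fun g => dih_conj g x).
Proof. by move=> g h /(congr1 val) /conjg_inj /val_inj. Qed.

Lemma wr_rotM g alpha beta :
  wr_rot g (alpha * beta) = (wr_rot g alpha * wr_rot (dih_conj g alpha.2) beta)%R.
Proof. by rewrite /wr_rot wrM1. Qed.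

Lemma wr_rot_neq0 g alpha : wr_rot g alpha != 0%R.
Proof. exact: dih_rot_neq0. Qed.

(** A character of the wreath product: the top component only permutes the factors. *)
Definition wr_rot_prod alpha : F := (\prod_g wr_rot g alpha)%R.

Lemma wr_rot_prodM alpha beta :
  wr_rot_prod (alpha * beta) = (wr_rot_prod alpha * wr_rot_prod beta)%R.
Proof.
rewrite /wr_rot_prod (eq_bigr _ (fun g _ => wr_rotM g alpha beta)) big_split /=.
by congr (_ * _)%R; rewrite [RHS](reindex_inj (@dih_conj_inj alpha.2)).
Qed.

Lemma wr_rot_prod1 : wr_rot_prod 1 = 1%R.
Proof. by apply: big1 => g _; rewrite /wr_rot ffunE. Qed.

Lemma wr_rot_prodX alpha k : wr_rot_prod (alpha ^+ k) = (wr_rot_prod alpha ^+ k)%R.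
Proof.
by elim: k => [|k IHk]; rewrite ?wr_rot_prod1 // expgS wr_rot_prodM IHk exprS.
Qed.

Lemma wr_rot_prod_neq0 alpha : wr_rot_prod alpha != 0%R.
Proof. by apply/prodf_neq0 => g _; apply: wr_rot_neq0. Qed.

Lemma wr_rot_prodJ alpha beta : wr_rot_prod (alpha ^ beta) = wr_rot_prod alpha.
Proof.
apply: (mulfI (wr_rot_prod_neq0 beta)).
by rewrite -wr_rot_prodM -conjgC wr_rot_prodM mulrC.
Qed.

Lemma card_dih_class : (zeta != 0)%R -> (zeta ^+ t = 1)%R -> #|{: C}| = #|K|.
Proof.
move=> zeta0 zeta1.
have zetaP : ((zeta != 0) && (zeta ^+ t == 1))%R by rewrite zeta0 zeta1 eqxx.
pose h (v : K) : C := @Sub _ _ C ((v, Sub zeta zetaP) : dihedral K t) (eqxx zeta).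
apply/esym/(@bij_eq_card _ _ h); exists (fun g => (val g).1) => [//|g].
apply: val_inj; apply: dih_eqP => //=.
by rewrite /dih_rot /= (eqP (valP g)).
Qed.

End WreathFacts.

(** x^(bc) x = x^(ad) = y^(bd) = (m x^c)^b. It serves for every abelian image of the torus knot
    group below. *)
Lemma torus_meridian_abelian (R : fieldType) (a b c d : nat) (m x y : R) :
  (a * d = (b * c).+1)%N ->
  (x != 0 -> x ^+ a = y ^+ b -> y ^+ d = m * x ^+ c -> x = m ^+ b)%R.
Proof.
move=> ad x0 xy ydm; apply: (mulfI (expf_neq0 (b * c) x0)).
by rewrite -exprSr -ad exprM xy exprAC ydm exprMn -!exprM mulnC mulrC.
Qed.

Lemma expr_coprime_eq1 (R : fieldType) (x : R) (j k : nat) :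
  coprime j k -> (x ^+ j = 1 -> x ^+ k = 1 -> x = 1)%R.
Proof.
move=> co_jk xj xk; have [j0|] := posnP j.
  by move: co_jk xk; rewrite j0 /coprime gcd0n => /eqP->.
move=> j_gt0; have [u v uv _] := egcdnP k j_gt0.
move/(congr1 (GRing.exp x)): uv; rewrite (eqP co_jk) exprD.
by rewrite !(mulnC _ j) !(mulnC _ k) !exprM xj xk !expr1n mul1r expr1.
Qed.

(** * A square knot representation in the wreath product *)

Section Witness.
Local Open Scope group_scope.
Variables (F K : finFieldType) (r t : nat) (zeta : K) (xi : F).
Variables (a b c d n : nat).
Hypotheses (r_prime : prime r) (xi_r : (xi ^+ r = 1)%R).
Hypotheses (zeta_t : (zeta ^+ t = 1)%R) (zeta_neq1 : (zeta != 1)%R).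
Hypotheses (t_gt0 : 0 < t) (t_dvd_b : t %| b) (ad : (a * d = (b * c).+1)%N).
Hypotheses (a_eq0 : (a%:R = 0 :> K)%R) (c_neq0 : (c%:R != 0 :> K)%R).
Hypotheses (n_gt0 : 0 < n) (n_eq0 : (n%:R = 0 :> F)%R) (co_n_tr : coprime n (t * r)).

Local Notation A := (dihedral F r : finGroupType).
Local Notation D := (dihedral K t : finGroupType).
Local Notation C := (@dih_class K t zeta).
Local Notation W := (@wreath A K t zeta : finGroupType).

Lemma xiP : ((xi != 0) && (xi ^+ r == 1))%R.
Proof.
rewrite xi_r eqxx andbT; apply/eqP => xi0; move/eqP: xi_r.
by rewrite xi0 expr0n (gtn_eqF (prime_gt0 r_prime)) eq_sym oner_eq0.
Qed.

Lemma zetaP : ((zeta != 0) && (zeta ^+ t == 1))%R.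
Proof.
rewrite zeta_t eqxx andbT; apply/eqP => zeta0; move/eqP: zeta_t.
by rewrite zeta0 expr0n (gtn_eqF t_gt0) eq_sym oner_eq0.
Qed.

Definition rot_xi : A := (0%R, Sub xi xiP).
Definition rot_zeta : D := (0%R, Sub zeta zetaP).
Definition wr_top (x : D) : W := ([ffun=> 1], x).
Definition wr_const : W := ([ffun=> rot_xi], 1 : D).

(** The dihedral representation sends x to [x_hat], killed by a = 0 in K, and y to [rot_zeta ^+ a].
    Since t divides b and a d = b c + 1, y^d becomes [rot_zeta] and the meridian becomes [m_hat]. *)
Definition x_hat : D := translation t 1%R.
Definition m_hat : D := rot_zeta * x_hat ^- c.

Lemma rot_m_hat : dih_rot m_hat = zeta.
Proof. by rewrite dih_rotM dih_rotV dih_rotX expr1n invr1 mulr1. Qed.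

(* m_hat has rotation zeta, so it is itself a point of C, fixed by m_hat. *)
Definition base_pt : C := Sub m_hat (introT eqP rot_m_hat).

(* rot_zeta moves base_pt, so conjugating by twist^-1 multiplies the component
   of wr_top rot_zeta there by rot_xi^-1. *)
Definition twist : W := ([ffun g => if g == base_pt then rot_xi^-1 else 1], 1 : D).
(** The factors [wr_const ^+ b] and [wr_const ^+ a] are the abelian representation with meridian
    [wr_const]. The y-part may be conjugated on its own, because the remaining factors of x^a and
    y^b are both trivial. *)
Definition witness_x : W := wr_const ^+ b * wr_top x_hat.
Definition witness_y : W := wr_const ^+ a * wr_top (rot_zeta ^+ a) ^ twist^-1.
Definition witness_m : W := witness_y ^+ d * witness_x ^- c.
(** It is supported at a fixed point of the meridian where the meridian is trivial, so the two
    commute; n = 0 in F kills its n-th power. *)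
Definition bump : W :=
  ([ffun g => if g == base_pt then translation r 1%R else 1], 1 : D).

Lemma wr_topM x y : wr_top (x * y) = wr_top x * wr_top y.
Proof. by apply: wr_eqP => // g; rewrite wrM1 !ffunE mul1g. Qed.

Lemma wr_topX x k : wr_top (x ^+ k) = wr_top x ^+ k.
Proof.
elim: k => [|k IHk]; last by rewrite !expgS wr_topM IHk.
by apply: wr_eqP => // g; rewrite !ffunE.
Qed.

Lemma wr_top1 : wr_top 1 = 1.
Proof. exact: (wr_topX 1 0). Qed.

Lemma commute_const_top x : commute wr_const (wr_top x).
Proof.
apply: wr_eqP => [g|]; last by rewrite !wrM2 mul1g mulg1.
by rewrite !wrM1 !ffunE mulg1 mul1g.
Qed.

Lemma commute_const_twist : commute wr_const twist.
Proof.
apply: wr_eqP => [g|]; rewrite ?wrM1 ?wrM2 //= !ffunE /= !dih_conj1.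
by case: ifP; rewrite ?mulg1 ?mul1g ?mulgV ?mulVg.
Qed.

Lemma wr_const_exp1 k : (wr_const ^+ k).2 = 1 :> D.
Proof. by rewrite wrX2 expg1n. Qed.

Lemma x_hat_a : x_hat ^+ a = 1.
Proof. by rewrite translationX a_eq0. Qed.

Lemma rot_zeta_t : rot_zeta ^+ t = 1.
Proof. by apply: dih_expr_root. Qed.

Lemma rot_zeta_b : rot_zeta ^+ b = 1.
Proof. by have [j ->] := dvdnP t_dvd_b; rewrite mulnC expgM rot_zeta_t expg1n. Qed.

Lemma commute_const_conj x : commute wr_const (wr_top x ^ twist^-1).
Proof.
apply: commuteM; first exact/commuteV/commuteV/commute_const_twist.
apply: commuteM; first exact: commute_const_top.
exact/commuteV/commute_const_twist.
Qed.

Lemma witness_x_expa : witness_x ^+ a = wr_const ^+ (a * b).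
Proof.
rewrite expgMn; last exact/commute_sym/commuteX/commute_sym/commute_const_top.
by rewrite -wr_topX x_hat_a wr_top1 mulg1 -expgM mulnC.
Qed.

Lemma witness_y_exp k :
  witness_y ^+ k = wr_const ^+ (a * k) * wr_top (rot_zeta ^+ (a * k)) ^ twist^-1.
Proof.
rewrite expgMn; last exact/commute_sym/commuteX/commute_sym/commute_const_conj.
by rewrite -conjXg -wr_topX -!expgM.
Qed.

Lemma witness_x_y : witness_x ^+ a = witness_y ^+ b.
Proof.
rewrite witness_x_expa witness_y_exp (mulnC a b) (expgM rot_zeta) rot_zeta_b expg1n.
by rewrite wr_top1 conj1g mulg1.
Qed.

(** The powers of [wr_const] commute with the rest and collect to the exponent a d - b c = 1. *)
Lemma witness_mE :
  witness_m = wr_const * (wr_top rot_zeta ^ twist^-1) * wr_top (x_hat ^- c).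
Proof.
have -> : wr_top (x_hat ^- c) = wr_top x_hat ^- c.
  apply: (mulgI (wr_top x_hat ^+ c)).
  by rewrite mulgV -wr_topX -wr_topM mulgV wr_top1.
rewrite /witness_m witness_y_exp ad [rot_zeta ^+ _]expgS expgM rot_zeta_b expg1n mulg1.
rewrite expgMn; last exact/commute_sym/commuteX/commute_sym/commute_const_top.
rewrite -expgM invMg expgS.
have := commute_const_conj rot_zeta; move: (wr_top rot_zeta ^ _) => y' comm_y'.
have commP : commute (wr_const ^+ (b * c)) (y' * wr_top x_hat ^- c).
  apply/commute_sym/commuteX/commute_sym/commuteM => //.
  exact/commuteV/commuteX/commute_const_top.
by rewrite -!mulgA; congr (_ * _); rewrite (mulgA y') mulgA commP mulgK.
Qed.

Lemma witness_m_top : witness_m.2 = m_hat :> D.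
Proof. by rewrite witness_mE !wrM2 !wrV2 !invg1 !mul1g mulg1. Qed.

Lemma m_hat_base : dih_conj base_pt m_hat = base_pt.
Proof. by apply: val_inj; rewrite /= /conjg mulKg. Qed.

(** Otherwise [rot_zeta] would commute with [m_hat], hence with the translation by c, which is
    nonzero in K. *)
Lemma rot_zeta_base : dih_conj base_pt rot_zeta != base_pt.
Proof.
apply/eqP => /(congr1 val) /= /conjg_fixP/commgP comm.
have {comm} : commute (x_hat ^+ c) rot_zeta.
  apply/commute_sym; rewrite -(invgK (x_hat ^+ c)); apply: commuteV.
  have -> : x_hat ^- c = rot_zeta^-1 * m_hat by rewrite mulKg.
  by apply: commuteM; [exact/commuteV|exact: commute_sym].
rewrite translationX => /commute_sym/commute_translation.
by move=> /(_ c_neq0) /eqP; rewrite (negbTE zeta_neq1).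
Qed.

Lemma witness_m_base : witness_m.1 base_pt = 1.
Proof.
rewrite witness_mE conjgE invgK !wrM1 !wrM2 /= !invg1 !dih_conj1 !ffunE dih_conj1 eqxx.
by rewrite (negbTE rot_zeta_base) invg1 mul1g !mulg1 mulgV.
Qed.

(** The twist hides xi at the base point but, being a conjugation, cannot change the product over
    all points. *)
Lemma wr_rot_prod_witness_m : wr_rot_prod witness_m = (xi ^+ #|K|)%R.
Proof.
have wr_rot_prod_top x : wr_rot_prod (wr_top x) = 1%R.
  by apply: big1 => g _; rewrite /wr_rot ffunE.
rewrite witness_mE 2!wr_rot_prodM wr_rot_prodJ !wr_rot_prod_top !mulr1.
rewrite -(card_dih_class (proj1 (andP zetaP)) zeta_t) -prodr_const.
by apply: eq_bigr => g _; rewrite /wr_rot ffunE.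
Qed.

Definition rotational (alpha : W) := forall g, (alpha.1 g).1 = 0%R.

Lemma rotationalM alpha beta :
  rotational alpha -> rotational beta -> rotational (alpha * beta).
Proof. by move=> rotA rotB g; rewrite wrM1 /= rotA rotB mulr0 addr0. Qed.

Lemma rotationalV alpha : rotational alpha -> rotational alpha^-1.
Proof. by move=> rotA g; rewrite ffunE /= rotA mulr0 oppr0. Qed.

Lemma rotational_witness_m : rotational witness_m.
Proof.
have rot_top x : rotational (wr_top x) by move=> g; rewrite ffunE.
have rot_twist : rotational twist.
  by move=> g; rewrite ffunE; case: ifP => //= _; rewrite mulr0 oppr0.
rewrite witness_mE conjgE invgK; do ?apply: rotationalM => //; last exact: rotationalV.
by move=> g; rewrite ffunE.
Qed.

(** The t-th power has trivial top, and its components are pure rotations, of order dividing r. *)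
Lemma witness_m_exp : witness_m ^+ (t * r) = 1.
Proof.
have m2 : (witness_m ^+ t).2 = 1 :> D.
  by rewrite wrX2 witness_m_top dih_expr_root // rot_m_hat.
have rot_mX k : rotational (witness_m ^+ k).
  elim: k => [|k IHk]; first by move=> g; rewrite ffunE.
  by rewrite expgS; apply: rotationalM => //; apply: rotational_witness_m.
rewrite expgM; apply: wr_eqP => [g|]; last by rewrite wrX2 m2 expg1n.
rewrite wrX_fix ?m2 ?dih_conj1 // ffunE; apply: dih_eqP.
  by rewrite dih_fstX rot_mX mul0r.
by rewrite dih_rotX dih_rot_unity.
Qed.

Lemma bumpE g : bump.1 g = if g == base_pt then translation r 1%R else 1.
Proof. by rewrite ffunE. Qed.

Lemma commute_bump : commute witness_m bump.
Proof.
apply: wr_eqP => [g|]; last by rewrite !wrM2 mul1g mulg1.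
rewrite (wrM1 witness_m) (wrM1 bump) witness_m_top dih_conj1 !bumpE.
have [->|g_neq] := eqVneq g base_pt.
  by rewrite m_hat_base eqxx witness_m_base mul1g mulg1.
have/negbTE-> : dih_conj g m_hat != base_pt.
  apply: contraNneq g_neq => g_base.
  by apply/eqP/(@dih_conj_inj _ _ _ m_hat); rewrite m_hat_base.
by rewrite mulg1 mul1g.
Qed.

Lemma bump_n : bump ^+ n = 1.
Proof.
apply: wr_eqP => [g|]; last by rewrite wrX2 expg1n.
rewrite wrX_fix ?dih_conj1 // bumpE ffunE; case: ifP => _; last exact: expg1n.
by rewrite translationX n_eq0.
Qed.

Lemma meridian_root : {nu : W | nu ^+ n = witness_m &
  dih_conj base_pt nu.2 = base_pt /\ nu.1 base_pt = translation r 1%R}.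
Proof.
have [k j kn _] := egcdnP (t * r) n_gt0.
(* As k n = j t r + 1, the power [witness_m ^+ k] is already an n-th root; [bump] adds the
   translation at the base point. *)
exists (witness_m ^+ k * bump).
  rewrite expgMn; last exact/commute_sym/commuteX/commute_sym/commute_bump.
  rewrite bump_n mulg1 -expgM kn (eqP co_n_tr) addn1 expgS mulnC expgM witness_m_exp.
  by rewrite expg1n mulg1.
have m_fix : dih_conj base_pt (witness_m ^+ k).2 = base_pt.
  by rewrite wrX2 witness_m_top dih_conjX_fix // m_hat_base.
rewrite wrM2 dih_conjM m_fix dih_conj1; split=> //.
rewrite wrM1 m_fix wrX_fix ?witness_m_top ?m_hat_base // witness_m_base expg1n mul1g.
by rewrite bumpE eqxx.
Qed.

Lemma square_witness : exists (nu x y : W) (p : C),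
  [/\ x ^+ a = y ^+ b, y ^+ d * x ^- c = nu ^+ n, (x ^+ a).2 = 1 :> D
    & wr_rot p (x ^+ a) = (xi ^+ (a * b))%R] /\
  [/\ dih_rot (nu ^+ n).2 = zeta, dih_conj p nu.2 = p, nu.1 p = translation r 1%R,
      (nu ^+ n).1 p = 1 & wr_rot_prod (nu ^+ n) = (xi ^+ #|K|)%R].
Proof.
have [nu nu_n [nu_fix nu_p]] := meridian_root.
exists nu, witness_x, witness_y, base_pt; rewrite nu_n; split; split=> //.
- exact: witness_x_y.
- by rewrite witness_x_expa wr_const_exp1.
- by rewrite witness_x_expa /wr_rot wrX_fix ?dih_conj1 // ffunE dih_rotX.
- by rewrite witness_m_top rot_m_hat.
- exact: witness_m_base.
exact: wr_rot_prod_witness_m.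
Qed.

End Witness.

(** * Its failure to extend to the granny knot *)

Section Obstruction.
Local Open Scope group_scope.
Variables (F K : finFieldType) (r t : nat) (zeta : K) (xi : F).
Variables (a b c d : nat).
Hypotheses (zeta_t : (zeta ^+ t = 1)%R) (zeta_neq1 : (zeta != 1)%R).
Hypotheses (t_dvd_b : t %| b) (ad : (a * d = (b * c).+1)%N).
Hypotheses (a_eq0 : (a%:R = 0 :> K)%R) (xi_r : (xi ^+ r = 1)%R) (xi_neq0 : (xi != 0)%R).
Hypothesis co_r_card : coprime r #|K|.
Hypothesis zeta_neq0 : (zeta != 0)%R.
(** The powers of zeta generate K additively; the form is an induction principle, to be applied to
    membership in a subgroup. *)
Hypothesis zeta_span : forall P : K -> Prop, P 1%R ->
  (forall u v, P u -> P v -> P (u + v)%R) -> (forall u, P u -> P (zeta * u)%R) ->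
  forall v, P v.

Local Notation D := (dihedral K t : finGroupType).
Local Notation C := (@dih_class K t zeta).
Local Notation W := (@wreath (dihedral F r) K t zeta : finGroupType).

Variables (m w z : W) (p : C).
Hypotheses (wz : w ^+ a = z ^+ b) (mer : z ^+ d * w ^- c = m).
Hypotheses (m_rot : dih_rot m.2 = zeta) (m_fix : dih_conj p m.2 = p).
Hypotheses (m_p : m.1 p = 1) (m_prod : wr_rot_prod m = (xi ^+ #|K|)%R).

Lemma z_expd : z ^+ d = m * w ^+ c.
Proof. by rewrite -mer mulgKV. Qed.

(** In the abelian quotient of rotations, w goes to the b-th power of the meridian, here zeta^b =
    1. *)
Lemma w_top_translation : w.2 = translation t w.2.1.
Proof.
apply: dih_eqP => //; rewrite [RHS](_ : _ = 1)%R //.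
have wz2 : (dih_rot w.2 ^+ a = dih_rot z.2 ^+ b)%R.
  by rewrite -!dih_rotX -!wrX2 wz.
have rot_zd : (dih_rot z.2 ^+ d = dih_rot m.2 * dih_rot w.2 ^+ c)%R.
  by rewrite -!dih_rotX -dih_rotM -!wrX2 z_expd.
rewrite (torus_meridian_abelian ad (dih_rot_neq0 _) wz2 rot_zd) m_rot.
by have [j ->] := dvdnP t_dvd_b; rewrite mulnC exprM zeta_t expr1n.
Qed.

Lemma w_expa_top : (w ^+ a).2 = 1 :> D.
Proof.
by rewrite wrX2 w_top_translation translationX -mulr_natr a_eq0 mulr0.
Qed.

Lemma rot_w_expa_trivial : w.2.1 = 0%R -> wr_rot p (w ^+ a) = 1%R.
Proof.
move=> w0; have w2 : w.2 = 1 :> D by rewrite w_top_translation w0.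
(* On top, z = z^(bc + 1) = (z^d)^a and z^d = m. *)
have z2 : z.2 = m.2 ^+ a :> D.
  have zb : z.2 ^+ b = 1 :> D by rewrite -wrX2 -wz w_expa_top.
  rewrite -[LHS]mulg1 -[X in _ * X](expg1n _ c) -zb -expgM -expgS -ad mulnC expgM.
  by rewrite -(wrX2 z) z_expd wrM2 wrX2 w2 expg1n mulg1.
(* Both w and z now fix p, so the rotation at p is multiplicative on them, and m has rotation 1
   there. *)
have z_fix : dih_conj p z.2 = p by rewrite z2 dih_conjX_fix.
have w_fix : dih_conj p w.2 = p by rewrite w2 dih_conj1.
have rotX (alpha : W) k : dih_conj p alpha.2 = p ->
    wr_rot p (alpha ^+ k) = (wr_rot p alpha ^+ k)%R.
  by move=> fix_p; rewrite /wr_rot wrX_fix // dih_rotX.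
have rot_wz : (wr_rot p w ^+ a = wr_rot p z ^+ b)%R by rewrite -!rotX // wz.
have rot_zd : (wr_rot p z ^+ d = 1 * wr_rot p w ^+ c)%R.
  by rewrite -!rotX // z_expd wr_rotM m_fix [wr_rot p m]/wr_rot m_p.
rewrite rotX // (torus_meridian_abelian ad (wr_rot_neq0 _ _) rot_wz rot_zd).
by rewrite !expr1n.
Qed.

(** As [w ^+ a] has trivial top, alpha contributes the same factor on both sides of the commutation,
    and it cancels. *)
Lemma rot_w_expa_conj alpha g :
  commute (w ^+ a) alpha -> wr_rot (dih_conj g alpha.2) (w ^+ a) = wr_rot g (w ^+ a).
Proof.
move=> comm; apply: (mulfI (wr_rot_neq0 g alpha)).
by rewrite -wr_rotM -comm wr_rotM w_expa_top dih_conj1 mulrC.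
Qed.

Definition rot_stab : {set D} :=
  [set x : D | [forall g : C, wr_rot (dih_conj g x) (w ^+ a) == wr_rot g (w ^+ a)]].

Lemma rot_stab_group_set : group_set rot_stab.
Proof.
apply/group_setP; split=> [|x y].
  by rewrite inE; apply/forallP=> g; rewrite dih_conj1.
rewrite !inE => /forallP stx /forallP sty; apply/forallP=> g.
by rewrite dih_conjM (eqP (sty _)) (eqP (stx _)).
Qed.
Canonical rot_stab_group := Group rot_stab_group_set.

Lemma rot_stab_commute alpha :
  commute (w ^+ a) alpha -> (alpha.2 : D) \in rot_stab.
Proof. by move=> comm; rewrite inE; apply/forallP=> g; rewrite rot_w_expa_conj. Qed.

(** The element w^a = z^b commutes with w and z, so the stabiliser contains the nonzero translation
    on top of w and, through the meridian, all its multiples by powers of zeta. *)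
Lemma translation_stab v : w.2.1 <> 0%R -> (translation t v : D) \in rot_stab.
Proof.
move=> w0.
have comm_w : commute (w ^+ a) w by apply/commute_sym/commuteX.
have comm_z : commute (w ^+ a) z by rewrite wz; apply/commute_sym/commuteX.
have w_st := rot_stab_commute comm_w.
have m_st : (m.2 : D) \in rot_stab.
  apply: rot_stab_commute; rewrite -mer.
  by apply/commuteM/commuteV/commuteX => //; apply: commuteX.
rewrite -[v](mulfVK (introN eqP w0)); move: (v / _)%R => {}v.
elim/zeta_span: v => [|u v|u].
- by rewrite mul1r -w_top_translation.
- by rewrite mulrDl -translationM; apply: groupM.
have -> : (zeta * u * w.2.1 = dih_rot m.2 * (u * w.2.1))%R by rewrite m_rot mulrA.
by rewrite -translationJV => u_st; rewrite groupJ ?groupV.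
Qed.

Lemma rot_w_expa_const g : w.2.1 <> 0%R -> wr_rot g (w ^+ a) = wr_rot p (w ^+ a).
Proof.
(* Conjugation by the translation by v adds (zeta - 1) v to the first coordinate of g. *)
move=> w0; pose v := (((val p).1 - (val g).1) / (zeta - 1))%R.
suff <- : dih_conj g (translation t v) = p.
  by have := translation_stab v w0; rewrite inE => /forallP/(_ g)/eqP.
apply: val_inj; apply: dih_eqP.
  have zv : (zeta * v = (val p).1 - (val g).1 + v)%R.
    by apply/eqP; rewrite -subr_eq -[X in (_ - X)%R]mul1r -mulrBl mulrC divfK ?subr_eq0.
  rewrite /= invr1 !mul1r (eqP (valP g)) zv.
  by rewrite [in LHS]addrC (addrA (val g).1) (addrC (val g).1) subrK addrK.
by transitivity zeta; [|apply/esym]; apply/eqP; apply: (valP (_ : C)).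
Qed.

(** By constancy, the product over all points is the #|K|-th power of the value at p. The product is
    also xi^(ab #|K|), and #|K|-th powers are injective on r-th roots of unity. *)
Lemma rot_w_expa_nontrivial : w.2.1 <> 0%R -> wr_rot p (w ^+ a) = (xi ^+ (a * b))%R.
Proof.
move=> w0.
have prod_wz : (wr_rot_prod w ^+ a = wr_rot_prod z ^+ b)%R.
  by rewrite -!wr_rot_prodX wz.
have prod_zd : (wr_rot_prod z ^+ d = wr_rot_prod m * wr_rot_prod w ^+ c)%R.
  by rewrite -!wr_rot_prodX -wr_rot_prodM z_expd.
have prod_w := torus_meridian_abelian ad (wr_rot_prod_neq0 _) prod_wz prod_zd.
have : (wr_rot p (w ^+ a) ^+ #|K| = xi ^+ (a * b) ^+ #|K|)%R.
  rewrite -(card_dih_class zeta_neq0 zeta_t) -prodr_const.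
  rewrite (eq_bigr (fun g => wr_rot g (w ^+ a))) => [|g _]; last first.
    exact/esym/rot_w_expa_const.
  rewrite -/(wr_rot_prod _) wr_rot_prodX prod_w m_prod -!exprM.
  rewrite (card_dih_class zeta_neq0 zeta_t).
  by congr (_ ^+ _)%R; rewrite mulnC (mulnC b).
set x := wr_rot _ _; set y := (xi ^+ (a * b))%R => xyK.
have xr : (x ^+ r = 1)%R by apply: dih_rot_unity.
have yr : (y ^+ r = 1)%R by rewrite -exprM mulnC exprM xi_r expr1n.
have y0 : (y != 0)%R by rewrite expf_neq0.
apply/eqP; rewrite -[y]mul1r -(can2_eq (divfK y0) (mulfK y0)); apply/eqP.
apply: (expr_coprime_eq1 co_r_card).
  by rewrite expr_div_n xr yr divr1.
by rewrite expr_div_n xyK divff // expf_neq0.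
Qed.

End Obstruction.

(** * Witness and obstruction combined *)

Lemma wreath_witness (F K : finFieldType) (r t : nat) (zeta : K) (xi : F)
    (a b c d n : nat) :
  prime r -> coprime r (2 * a * b) -> (xi ^+ r = 1)%R -> (xi != 1)%R ->
  (zeta ^+ t = 1)%R -> (zeta != 1)%R -> (0 < t)%N -> (t %| b)%N ->
  (a * d = (b * c).+1)%N -> (a%:R = 0 :> K)%R -> (c%:R != 0 :> K)%R ->
  (0 < n)%N -> (n%:R = 0 :> F)%R -> coprime n (t * r) -> coprime r #|K| ->
  (forall P : K -> Prop, P 1%R ->
    (forall u v, P u -> P v -> P (u + v)%R) -> (forall u, P u -> P (zeta * u)%R) ->
    forall v, P v) ->
  exists (nu : @wreath (dihedral F r) K t zeta) p0,
    p0 \in torus_pairs a b c d (nu ^+ n)%g /\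
    (forall p, p \in torus_pairs a b c d (nu ^+ n)%g ->
      (nu ^ (p0.1 ^+ a * p.1 ^+ a) != nu)%g).
Proof.
move=> r_prime co_r xi_r xi1 zeta_t zeta1 t_gt0 t_b ad a0 c0 n_gt0 n0 co_n co_K span.
have zeta0 := proj1 (andP (zetaP zeta_t t_gt0)).
have xi0 := proj1 (andP (xiP r_prime xi_r)).
have [nu [x [y [p [[xy mer xa2 rot_xa] [m_rot nu_fix nu_p m_p m_prod]]]]]] :=
  square_witness r_prime xi_r zeta_t zeta1 t_gt0 t_b ad a0 c0 n_gt0 n0 co_n.
exists nu, (x, y); split; first exact/torus_pairsP.
move=> [w z] /torus_pairsP[wz mer']; rewrite conjg_eqP; apply/eqP => comm.
have m_fix : dih_conj p (nu ^+ n)%g.2 = p by rewrite wrX2 dih_conjX_fix.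
(* At p, both x^a and w^a have trivial top and nu is a nonzero translation, so the product of their
   components there has rotation 1. *)
have rot_prod : (xi ^+ (a * b) * wr_rot p (w ^+ a)%g = 1)%R.
  pose at_p (alpha : @wreath (dihedral F r) K t zeta) := alpha.1 p.
  rewrite -rot_xa; have /esym := congr1 at_p comm; rewrite /at_p.
  rewrite !wrM1 nu_fix nu_p wrM2 xa2 (w_expa_top zeta_t t_b ad a0 wz mer' m_rot).
  rewrite mulg1 dih_conj1.
  by rewrite nu_p => comm_p; exact: (commute_translation (oner_neq0 _) comm_p).
have xi_pow k : coprime r k -> (xi ^+ k != 1)%R.
  move=> co_k; apply: contra xi1 => /eqP xik; apply/eqP.
  by apply: expr_coprime_eq1 co_k _ xik.
(* The two cases give xi^(ab) = 1 and xi^(2ab) = 1. *)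
have [w0|/eqP w0] := eqVneq w.2.1 0%R; move: rot_prod.
  rewrite (rot_w_expa_trivial zeta_t t_b ad a0 wz mer' m_rot m_fix m_p w0) mulr1.
  by apply/eqP/xi_pow; move: co_r; rewrite -mulnA coprimeMr => /andP[].
rewrite (rot_w_expa_nontrivial zeta_t zeta1 t_b ad a0 xi_r xi0 co_K zeta0 span p
  wz mer' m_rot m_prod w0).
by apply/eqP; rewrite -expr2 -exprM xi_pow // mulnC mulnA.
Qed.

(** * Roots of unity in the splitting fields *)

Lemma split_unity_root (q r : nat) (F : fieldExtType 'F_q) :
  (1 < r)%N -> (r%:R != 0 :> F)%R -> is_splitting_field_unity r F ->
  exists2 xi : F, (xi ^+ r = 1)%R & (xi != 1)%R.
Proof.
move=> r_gt1 r0 [rs Xr_rs _].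
have uniq_rs : uniq rs.
  by rewrite -separable_prod_XsubC -(eqp_separable Xr_rs) separable_Xn_sub_1.
have size_rs : size rs = r.
  have := eqp_size Xr_rs; rewrite size_XnsubC ?size_prod_XsubC; [by case|exact: ltnW].
have [xi xi_rs xi1] : exists2 xi, xi \in rs & xi != 1%R.
  apply/hasP; rewrite -[has _ _]negbK -all_predC; apply/negP => /allP all1.
  have := uniq_leq_size uniq_rs (s2 := [:: 1%R]) _; rewrite size_rs leqNgt r_gt1 /=.
  by move=> H; apply: notF; apply: H => z /all1; rewrite /= negbK inE.
exists xi => //; apply/eqP; rewrite -subr_eq0.
have : root (\prod_(z <- rs) ('X - z%:P)) xi by rewrite root_prod_XsubC.
by rewrite -(eqp_root Xr_rs) rootE !hornerE.
Qed.

(** As t is prime, zeta is a primitive root, so K is generated by zeta over the prime field and its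
    elements are polynomials in zeta, built up by Horner's scheme. *)
Lemma unity_root_span (s t : nat) (K : fieldExtType 'F_s) (zeta : K) :
  prime s -> prime t -> is_splitting_field_unity t K ->
  (zeta ^+ t = 1)%R -> (zeta != 1)%R ->
  forall P : K -> Prop, P 1%R ->
    (forall u v, P u -> P v -> P (u + v)%R) -> (forall u, P u -> P (zeta * u)%R) ->
    forall v, P v.
Proof.
move=> s_prime t_prime [rs Xt_rs K_rs] zeta_t zeta1 P P1 PD PZ v.
have [m prim_m m_dvd] := prim_order_exists (prime_gt0 t_prime) zeta_t.
have prim_t : (t.-primitive_root zeta)%R.
  rewrite -(prime_nt_dvdP t_prime _ m_dvd) //; apply: contraNneq zeta1 => m1.
  by have := prim_expr_order prim_m; rewrite m1 expr1 => ->.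
have rs_zeta : (<<1 & rs>> <= <<1; zeta>>)%VS.
  apply/Fadjoin_seqP; split=> [|z]; first exact: subv_adjoin.
  rewrite -root_prod_XsubC -(eqp_root Xt_rs) rootE !hornerE subr_eq0 => /eqP zt.
  by have [i ->] := prim_rootP prim_t zt; rewrite rpredX ?memv_adjoin.
have Pnat k : P (k.+1)%:R%R.
  by elim: k => [|k IHk] //; rewrite mulrSr; apply: PD.
have s_pchar : s \in [pchar K]%R by rewrite pchar_lalg pchar_Fp.
(* Zero is reached as the sum of s copies of 1. *)
have P0 : P 0%R.
  by have := Pnat s.-1; rewrite (prednK (prime_gt0 s_prime)) (pcharf0 s_pchar).
have [p ->] : exists p, v = (map_poly (in_alg K) p).[zeta]%R.
  by apply/Fadjoin1_polyP/(subvP rs_zeta); rewrite K_rs memvf.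
elim/poly_ind: p => [|p k IHp]; first by rewrite rmorph0 horner0.
rewrite rmorphD rmorphM /= map_polyX map_polyC hornerMXaddC mulrC.
apply: PD; first exact: PZ.
rewrite /= -[k]natr_Zp; move: (nat_of_ord k) => {k}[|k].
  by rewrite scale0r.
by rewrite scaler_nat.
Qed.

(** * Natural exponents and the conclusion *)

Lemma nonneg_bezout (a b : nat) (c d : int) :
  (0 < a)%N -> (0 < b)%N -> (a%:Z * d - b%:Z * c = 1)%R ->
  exists c' d' k : nat,
    [/\ (c'%:Z = c + a%:Z * k%:Z)%R, (d'%:Z = d + b%:Z * k%:Z)%R
      & (a * d' = (b * c').+1)%N].
Proof.
(* Since a and b are at least 1, this shift makes both coefficients nonnegative. *)
move=> a_gt0 b_gt0 ad; pose k := (`|c| + `|d|)%N.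
have c_ge0 : (0 <= c + a%:Z * k%:Z)%R by rewrite /k; nia.
have d_ge0 : (0 <= d + b%:Z * k%:Z)%R by rewrite /k; nia.
exists `|(c + a%:Z * k%:Z)%R|%N, `|(d + b%:Z * k%:Z)%R|%N, k; split.
- by rewrite gez0_abs.
- by rewrite gez0_abs.
apply/eqP; rewrite -eqz_nat -addn1 PoszD !PoszM !gez0_abs //; apply/eqP.
by move: ad; rewrite !mulrDr !mulrA; lia.
Qed.

Theorem theorem4p1 (a b n : nat) (c d : int) (s t q r : nat)
    (F : fieldExtType 'F_q) (K : fieldExtType 'F_s) (zeta : K) :
  (2 <= a)%N -> (2 <= b)%N -> (2 <= n)%N ->
  coprime a b ->
  (a%:Z * d - b%:Z * c = 1)%R ->
  prime s -> (s %| a)%N -> prime t -> (t %| b)%N -> coprime (s * t) n ->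
  prime q -> (q %| n)%N ->
  prime r -> coprime r (2 * n * a * b) ->
  is_splitting_field_unity r F ->
  is_splitting_field_unity t K ->
  (zeta ^+ t = 1)%R -> (zeta <> 1)%R ->
  card_lt
    (group_Hom (generalised_knot_group n (granny_knot a b c d)) (WW r t F zeta))
    (group_Hom (generalised_knot_group n (square_knot a b c d)) (WW r t F zeta)).
Proof.
move=> a_gt1 b_gt1 n_gt1 _ ad s_prime s_a t_prime t_b co_st_n q_prime q_n r_prime.
move=> co_r splitF splitK zeta_t /eqP zeta1.
have [c' [d' [k [c'E d'E ad']]]] := nonneg_bezout (ltnW a_gt1) (ltnW b_gt1) ad.
have q_pchar : q \in [pchar F]%R by rewrite pchar_lalg pchar_Fp.
have s_pchar : s \in [pchar K]%R by rewrite pchar_lalg pchar_Fp.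
have a0 : (a%:R = 0 :> K)%R by apply/eqP; rewrite -(dvdn_pcharf s_pchar).
have n0 : (n%:R = 0 :> F)%R by apply/eqP; rewrite -(dvdn_pcharf q_pchar).
(* s divides a, hence not c', by the Bezout relation. *)
have c0 : (c'%:R != 0 :> K)%R.
  rewrite -(dvdn_pcharf s_pchar); apply/negP => s_c'.
  have : s %| (b * c').+1 by rewrite -ad' dvdn_mulr.
  by rewrite -addn1 dvdn_addr ?dvdn_mull // dvdn1 => /eqP s1; move: s_prime; rewrite s1.
move: co_r; rewrite !coprimeMr => /andP[/andP[/andP[co_r2 co_rn] co_ra] co_rb].
have r0 : (r%:R != 0 :> F)%R.
  rewrite -(dvdn_pcharf q_pchar) dvdn_prime2 //; apply/eqP => qr.
  by move: co_rn; rewrite -qr prime_coprime // q_n.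
have [xi xi_r xi1] := split_unity_root (prime_gt1 r_prime) r0 splitF.
have co_n : coprime n (t * r).
  by move: co_st_n; rewrite coprimeMl coprimeMr ![coprime n _]coprime_sym => /andP[_ ->].
(* The order of K is a power of s, and s divides a, which is prime to r. *)
have co_r_card : coprime r #|finvect_type K|.
  have s_nat : s.-nat #|finvect_type K|.
    have /abelem_pgroup := @fin_ring_pchar_abelem s (finvect_type K) s_pchar.
    by rewrite /pgroup cardsT.
  rewrite coprime_sym (pnat_coprime s_nat) // pnatE // inE /=.
  by apply: contraTneq co_ra => ->; rewrite prime_coprime // s_a.
have co_r_2ab : coprime r (2 * a * b) by rewrite !coprimeMr co_r2 co_ra.
have [nu [p0 [Xp0 noXp]]] :=
  @wreath_witness (finvect_type F) (finvect_type K) r t zeta xi a b c' d' n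
    r_prime co_r_2ab xi_r xi1 zeta_t zeta1 (prime_gt0 t_prime) t_b
    ad' a0 c0 (ltnW n_gt1) n0 co_n co_r_card
    (unity_root_span s_prime t_prime splitK zeta_t zeta1).
exact: (card_lt_granny_square c'E d'E Xp0 noXp).
Qed.
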